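(* Let $\alpha$ be an infinite cardinal and $I=\{X: X\subseteq\alpha,\ X\text{ finite}\}$. There exists an $\alpha$-regular ultrafilter $U$ on $I$ such that every linearly ordered MV-algebra $\mathbf M=(M;\oplus,\neg,0)$ with $|M|\leq\alpha$ satisfies: (1) there are finite linearly ordered MV-algebras $\mathbf C_X$, $X\in I$, such that $\mathbf M$ embeds into $(\prod_{X\in I}\mathbf C_X)/U$; (2) $\mathbf M$ embeds into the ultrapower $(\prod_{X\in I}\mathbb Q\cap[0,1])/U$; (3) $\mathbf M$ embeds into the ultrapower $(\prod_{X\in I}[0,1])/U$.
   Context: An MV-algebra is an algebra $(A,\oplus,\neg,0)$ of type $(2,1,0)$ such that $\oplus$ is commutative and associative, $x\oplus 0=x$, $\neg\neg x=x$, $x\oplus 1=1$ where $1:=\neg 0$, and $\neg(\neg x\oplus y)\oplus y=\neg(\neg y\oplus x)\oplus x$; its order is $x\leq y$ iff $\neg x\oplus y=1$, and it is linearly ordered if this order is total. $[0,1]$ is the standard MV-algebra on the real unit interval with $x\oplus y=\min\{x+y,1\}$, $\neg x=1-x$, and $\mathbb Q\cap[0,1]$ is its subalgebra on the rationals. A proper filter $D$ on $I$ is $\alpha$-regular if there is $E\subseteq D$ with $|E|=\alpha$ such that each $i\in I$ belongs to only finitely many members of $E$. For algebras $\mathbf A_X$ and an ultrafilter $U$ on $I$, $(\prod_{X\in I}\mathbf A_X)/U$ is the quotient of the product by the congruence identifying $x,y$ iff $\{X: x(X)=y(X)\}\in U$.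
   Formalization: Parts (2) and (3) are stated only for M with 0 ≠ 1, since the one-element MV-algebra is linearly ordered but embeds in no ultrapower of [0,1] or Q∩[0,1]; part (1) covers all M. *)

(* Defs.v *)
From HB Require Import structures.
From mathcomp Require Import all_boot all_order all_algebra.
From mathcomp Require Import mathcomp_extra boolp classical_sets functions.
From mathcomp Require Import cardinality filter reals.
From mathcomp Require Import lra.

Set Implicit Arguments.
Unset Strict Implicit.
Unset Printing Implicit Defensive.

Import Order.TTheory GRing.Theory Num.Theory.
Local Open Scope classical_set_scope.

HB.mixin Record isMVAlgebra (T : Type) := {
  mvadd : T -> T -> T ;
  mvneg : T -> T ;
  mv0 : T ;
  mvaddC : commutative mvadd ;
  mvaddA : associative mvadd ;
  mvaddx0 : forall x, mvadd x mv0 = x ;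
  mvnegK : forall x, mvneg (mvneg x) = x ;
  mvaddx1 : forall x, mvadd x (mvneg mv0) = mvneg mv0 ;
  mv_lukasiewicz : forall x y,
    mvadd (mvneg (mvadd (mvneg x) y)) y = mvadd (mvneg (mvadd (mvneg y) x)) x
}.

#[short(type="mvAlgType")]
HB.structure Definition MVAlgebra := { T of isMVAlgebra T }.

Definition mv1 {A : mvAlgType} : A := mvneg mv0.

Definition mvle {A : mvAlgType} (x y : A) : Prop := mvadd (mvneg x) y = mv1.

Definition mv_linear (A : mvAlgType) : Prop :=
  forall x y : A, mvle x y \/ mvle y x.

Definition mv_embedding (A B : mvAlgType) (f : A -> B) : Prop :=
  [/\ injective f,
      forall x y, f (mvadd x y) = mvadd (f x) (f y),
      forall x, f (mvneg x) = mvneg (f x) &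
      f mv0 = mv0].

Definition mv_embeds (A B : mvAlgType) : Prop :=
  exists f : A -> B, mv_embedding f.

(* The unit interval of an ordered ring R: the standard MV-algebra [0, 1] for
   R : realType, and its subalgebra of rationals for R := rat. *)
Definition unitI (R : realDomainType) := {x : R | (0 <= x <= 1)%R}.

Section UnitIntervalMV.
Variable R : realDomainType.
Local Open Scope ring_scope.
Implicit Types x y : unitI R.

Lemma unitI_add_subproof x y : 0 <= Num.min (sval x + sval y) 1 <= 1.
Proof.
case: x y => [x /andP[x0 _]] [y /andP[y0 _]] /=.
by rewrite le_min addr_ge0 //= ler01 ge_min lexx orbT.
Qed.

Lemma unitI_neg_subproof x : 0 <= 1 - sval x <= 1.
Proof.
by case: x => [x /andP[x0 x1]] /=; rewrite subr_ge0 x1 gerBl x0.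
Qed.

Lemma unitI_0_subproof : 0 <= (0 : R) <= 1.
Proof. by rewrite lexx ler01. Qed.

Definition unitI_add x y : unitI R := exist (fun z : R => 0 <= z <= 1) _ (unitI_add_subproof x y).
Definition unitI_neg x : unitI R := exist (fun z : R => 0 <= z <= 1) _ (unitI_neg_subproof x).
Definition unitI_0 : unitI R := exist (fun z : R => 0 <= z <= 1) _ unitI_0_subproof.

Let addC : commutative unitI_add.
Proof. by move=> x y; apply: val_inj => /=; rewrite addrC. Qed.

Let addA : associative unitI_add.
Proof.
move=> [x hx] [y hy] [z hz]; apply: val_inj => /=.
by move: hx hy hz => /andP[? ?] /andP[? ?] /andP[? ?];
  case: (leP (x + y) 1) => ?; case: (leP (y + z) 1) => ?;
  do ![case: leP => ?]; lra.
Qed.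

Let addx0 x : unitI_add x unitI_0 = x.
Proof.
case: x => [x hx]; apply: val_inj => /=.
by rewrite addr0; apply/min_idPl; case/andP: hx.
Qed.

Let negK x : unitI_neg (unitI_neg x) = x.
Proof. by apply: val_inj => /=; rewrite opprB addrC subrK. Qed.

Let addx1 x : unitI_add x (unitI_neg unitI_0) = unitI_neg unitI_0.
Proof.
case: x => [x hx]; apply: val_inj => /=.
by rewrite subr0; apply/min_idPr; rewrite lerDr; case/andP: hx.
Qed.

Let luk x y : unitI_add (unitI_neg (unitI_add (unitI_neg x) y)) y =
  unitI_add (unitI_neg (unitI_add (unitI_neg y) x)) x.
Proof.
case: x y => [x hx] [y hy]; apply: val_inj => /=.
by move: hx hy => /andP[? ?] /andP[? ?];
  case: (leP (1 - x + y) 1) => ?; case: (leP (1 - y + x) 1) => ?;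
  do ![case: leP => ?]; lra.
Qed.

HB.instance Definition _ := isMVAlgebra.Build (unitI R)
  addC addA addx0 negK addx1 luk.

End UnitIntervalMV.

Section Ultraproduct.
Local Open Scope quotient_scope.
Variables (I : Type) (U : set_system I).
Context {UU : UltraFilter U}.
Variable A : I -> mvAlgType.

Definition mvprod : Type := forall i, A i.
HB.instance Definition _ := gen_eqMixin mvprod.
HB.instance Definition _ := gen_choiceMixin mvprod.

Definition ultra_rel (x y : mvprod) : bool := `[< U [set i | x i = y i] >].

Lemma ultra_rel_refl : reflexive ultra_rel.
Proof. by move=> x; apply/asboolP; apply: filterS filterT => i _. Qed.

Lemma ultra_rel_sym : symmetric ultra_rel.
Proof.
by move=> x y; apply/asboolP/asboolP; apply: filterS => i /= ->.
Qed.

Lemma ultra_rel_trans : transitive ultra_rel.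
Proof.
move=> y x z /asboolP xy /asboolP yz; apply/asboolP.
by apply: filterS2 xy yz => i /= -> ->.
Qed.

Canonical ultra_equiv :=
  EquivRel ultra_rel ultra_rel_refl ultra_rel_sym ultra_rel_trans.

Definition ultraproduct := {eq_quot ultra_equiv}.
HB.instance Definition _ := Choice.on ultraproduct.
HB.instance Definition _ := EqQuotient.on ultraproduct.

Definition prod_add (x y : mvprod) : mvprod :=
  fun i => mvadd (x i) (y i).
Definition prod_neg (x : mvprod) : mvprod := fun i => mvneg (x i).
Definition prod_0 : mvprod := fun i => mv0.

Definition ultra_add (x y : ultraproduct) : ultraproduct :=
  \pi_ultraproduct (prod_add (repr x) (repr y)).
Definition ultra_neg (x : ultraproduct) : ultraproduct :=
  \pi_ultraproduct (prod_neg (repr x)).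
Definition ultra_0 : ultraproduct := \pi_ultraproduct prod_0.

Lemma ultra_piP (x y : mvprod) :
  \pi_ultraproduct x = \pi_ultraproduct y <-> U [set i | x i = y i].
Proof.
split=> [/eqmodP/asboolP//|h]; apply/eqmodP; exact/asboolP.
Qed.

Lemma ultra_addE x y :
  ultra_add (\pi x) (\pi y) = \pi_ultraproduct (prod_add x y).
Proof.
apply/ultra_piP.
have hx : U [set i | repr (\pi_ultraproduct x) i = x i].
  by apply/ultra_piP; rewrite reprK.
have hy : U [set i | repr (\pi_ultraproduct y) i = y i].
  by apply/ultra_piP; rewrite reprK.
by apply: filterS2 hx hy => i /= hx hy; rewrite /prod_add hx hy.
Qed.

Lemma ultra_negE x : ultra_neg (\pi x) = \pi_ultraproduct (prod_neg x).
Proof.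
apply/ultra_piP.
have hx : U [set i | repr (\pi_ultraproduct x) i = x i].
  by apply/ultra_piP; rewrite reprK.
by apply: filterS hx => i /= hx; rewrite /prod_neg hx.
Qed.

Let addC : commutative ultra_add.
Proof.
elim/quotW=> x; elim/quotW=> y; rewrite !ultra_addE.
by congr (\pi _); apply: functional_extensionality_dep => i; exact: mvaddC.
Qed.

Let addA : associative ultra_add.
Proof.
elim/quotW=> x; elim/quotW=> y; elim/quotW=> z; rewrite !ultra_addE.
by congr (\pi _); apply: functional_extensionality_dep => i; exact: mvaddA.
Qed.

Let addx0 x : ultra_add x ultra_0 = x.
Proof.
elim/quotW: x => x; rewrite ultra_addE.
by congr (\pi _); apply: functional_extensionality_dep => i; exact: mvaddx0.
Qed.

Let negK x : ultra_neg (ultra_neg x) = x.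
Proof.
elim/quotW: x => x; rewrite !ultra_negE.
by congr (\pi _); apply: functional_extensionality_dep => i; exact: mvnegK.
Qed.

Let addx1 x : ultra_add x (ultra_neg ultra_0) = ultra_neg ultra_0.
Proof.
elim/quotW: x => x; rewrite ultra_negE ultra_addE.
by congr (\pi _); apply: functional_extensionality_dep => i; exact: mvaddx1.
Qed.

Let luk x y : ultra_add (ultra_neg (ultra_add (ultra_neg x) y)) y =
  ultra_add (ultra_neg (ultra_add (ultra_neg y) x)) x.
Proof.
elim/quotW: x => x; elim/quotW: y => y.
rewrite !(ultra_negE x, ultra_negE y) (ultra_addE (prod_neg x)).
rewrite (ultra_addE (prod_neg y)) !ultra_negE !ultra_addE.
congr (\pi _); apply: functional_extensionality_dep => i.
exact: mv_lukasiewicz.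
Qed.

HB.instance Definition _ := isMVAlgebra.Build ultraproduct
  addC addA addx0 negK addx1 luk.

End Ultraproduct.

Arguments ultraproduct {I} U {UU} A.

Definition finite_subset (alpha : Type) := {X : set alpha | finite_set X}.

(* The cardinal alpha is represented by a type of that cardinality. *)
Definition regular_filter (alpha I : Type) (D : set_system I) : Prop :=
  ProperFilter D /\
  exists E : set (set I),
    [/\ E `<=` D, (E #= [set: alpha])%card &
        forall i, finite_set [set e | E e /\ e i]].

(* Main.v *)
(** A linearly ordered MV-algebra M is the interval [[0, u]] of a totally ordered
    abelian group G (Chang). Fourier-Motzkin elimination shows that the signs of
    finitely many integer linear forms at a point of G are also realised at an
    integer point; applied to the forms [x + y - z], this maps any finite part
    of M injectively into a finite Lukasiewicz chain, preserving the operations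
    that stay inside that part. Since an ultrafilter containing every cone
    [{X | a \in X}] sees any finite set of elements of M inside almost every
    X, these partial embeddings glue to an embedding into the ultraproduct of
    the chains, each of which embeds into the rational and real unit
    intervals. *)

Require Import Defs.
From HB Require Import structures.
From mathcomp Require Import all_boot all_order all_algebra.
From mathcomp Require Import mathcomp_extra boolp classical_sets functions.
From mathcomp Require Import cardinality filter reals.
From mathcomp Require Import zify ring lra.

Set Implicit Arguments.
Unset Strict Implicit.
Unset Printing Implicit Defensive.

Import Order.TTheory GRing.Theory Num.Theory.
Local Open Scope classical_set_scope.

(** * Arithmetic and order in arbitrary MV-algebras *)

Section MVTheory.
Variable A : mvAlgType.
Implicit Types x y z : A.

Definition mvmul x y : A := mvneg (mvadd (mvneg x) (mvneg y)).

Lemma mvmulC x y : mvmul x y = mvmul y x.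
Proof. by rewrite /mvmul mvaddC. Qed.

Lemma mvmulA x y z : mvmul x (mvmul y z) = mvmul (mvmul x y) z.
Proof. by rewrite /mvmul !mvnegK mvaddA. Qed.

Lemma mvnegM x y : mvneg (mvmul x y) = mvadd (mvneg x) (mvneg y).
Proof. exact: mvnegK. Qed.

Lemma mvnegD x y : mvneg (mvadd x y) = mvmul (mvneg x) (mvneg y).
Proof. by rewrite /mvmul !mvnegK. Qed.

Lemma mvadd0x x : mvadd mv0 x = x.
Proof. by rewrite mvaddC mvaddx0. Qed.

Lemma mvadd1x x : mvadd mv1 x = mv1.
Proof. by rewrite mvaddC mvaddx1. Qed.

Lemma mvneg1 : mvneg mv1 = mv0 :> A.
Proof. exact: mvnegK. Qed.

Lemma mvaddNx x : mvadd (mvneg x) x = mv1.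
Proof. by have := mv_lukasiewicz x mv1; rewrite mvaddx1 mvneg1 mvadd0x. Qed.

Lemma mvaddxN x : mvadd x (mvneg x) = mv1.
Proof. by rewrite mvaddC mvaddNx. Qed.

Lemma mvmulNx x : mvmul (mvneg x) x = mv0.
Proof. by rewrite /mvmul mvnegK mvaddxN mvneg1. Qed.

Lemma mvle_neg x y : mvle x y -> mvle (mvneg y) (mvneg x).
Proof. by rewrite /mvle mvnegK mvaddC. Qed.

(** Both sides of the Lukasiewicz axiom compute the join of [x] and [y]; when [x <= y], one of them
    collapses to [y]. *)
Lemma mvle_subrK x y : mvle x y -> mvadd (mvmul y (mvneg x)) x = y.
Proof.
move=> xy; rewrite /mvmul mvnegK -[in RHS](mvadd0x y) -mvneg1 -xy.
exact/esym/mv_lukasiewicz.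
Qed.

Lemma mvle_addr x y : mvle x (mvadd y x).
Proof. by rewrite /mvle mvaddC -mvaddA mvaddxN mvaddx1. Qed.

Lemma mvle_add2r z x y : mvle x y -> mvle (mvadd x z) (mvadd y z).
Proof. by move=> /mvle_subrK <-; rewrite -mvaddA; exact: mvle_addr. Qed.

Lemma mvle_mul2r z x y : mvle x y -> mvle (mvmul x z) (mvmul y z).
Proof. by move=> xy; apply/mvle_neg/mvle_add2r/mvle_neg. Qed.

Lemma mvle_mulr x y : mvle (mvmul y x) x.
Proof. by rewrite -[X in mvle _ X]mvnegK; apply/mvle_neg/mvle_addr. Qed.

Lemma mvaddK x y : mvle x (mvneg y) -> mvmul (mvadd x y) (mvneg y) = x.
Proof.
move=> /mvle_neg; rewrite mvnegK => yx.
by rewrite -[RHS]mvnegK -(mvle_subrK yx) /mvmul !mvnegK.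
Qed.

End MVTheory.

(** * Mixed associativity of sum and product in chains *)

Section LinearMVTheory.
Variable A : mvAlgType.
Hypothesis Alin : mv_linear A.
Implicit Types a b c : A.

Lemma mvadd_neq1_le a b : mvadd a b <> mv1 -> mvle a (mvneg b).
Proof.
move=> ab; case: (Alin a (mvneg b)) => //.
by rewrite /mvle mvnegK mvaddC.
Qed.

(** Read in the ordered group, both sides are the positive part of [a + b + c - u]. If [a + b + c]
    stays below 1, both vanish. Otherwise, with [p] the left side, [b + c = p + mvneg a], and
    multiplying by [a] gives back [p] because [p <= a]. *)
Lemma mvadd_mul_mulA a b c :
  mvle a (mvneg b) -> mvle b (mvneg c) ->
  mvmul (mvadd a b) c = mvmul a (mvadd b c).
Proof.
wlog abc : a b c / mvadd (mvadd a b) c = mv1 => [hw|] ab bc.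
  have [/hw|] := pselect (mvadd (mvadd a b) c = mv1); first exact.
  move=> abc; have: mvle (mvadd a b) (mvneg c) by exact: mvadd_neq1_le.
  have: mvle (mvneg (mvneg (mvadd b c))) (mvneg a).
    by apply/mvle_neg/mvadd_neq1_le; rewrite mvaddA.
  by rewrite /mvle mvnegK /mvmul mvaddC => -> ->.
set p := mvmul (mvadd a b) c.
(* From [c <= mvneg b] follows [p <= (a + b) * mvneg b = a]. *)
have pa : mvle p a.
  rewrite -[X in mvle _ X](mvaddK ab) /p ![mvmul (mvadd a b) _]mvmulC.
  apply: mvle_mul2r; move/mvle_neg: bc; rewrite mvnegK //.
have cE : c = mvadd p (mvneg (mvadd a b)).
  rewrite -[LHS](@mvle_subrK _ (mvneg (mvadd a b))) ?mvnegK 1?mvmulC //.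
  by rewrite /mvle mvnegK.
have bcE : mvadd b c = mvadd p (mvneg a).
  rewrite cE mvaddC -mvaddA; congr mvadd; rewrite mvnegD.
  by apply: mvle_subrK; move/mvle_neg: ab; rewrite mvnegK.
rewrite bcE mvmulC -[X in mvmul _ X]mvnegK mvaddK //.
by rewrite mvnegK.
Qed.

Lemma mvmul_add_addA a b c :
  mvadd a b = mv1 -> mvadd b c = mv1 ->
  mvadd (mvmul a b) c = mvadd a (mvmul b c).
Proof.
move=> ab bc; apply: (can_inj (@mvnegK A)); rewrite !mvnegD !mvnegM.
by apply: mvadd_mul_mulA; rewrite /mvle !mvnegK.
Qed.

(** As [a + b] reaches 1, [b] splits as [a * b + mvneg a]; the summand [mvneg a] then cancels from
    [b + c], which has not been truncated. *)
Lemma mvmul_add_mulA a b c :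
  mvadd a b = mv1 -> mvadd b c <> mv1 ->
  mvadd (mvmul a b) c = mvmul a (mvadd b c).
Proof.
move=> ab bc.
have bE : b = mvadd (mvmul a b) (mvneg a).
  by rewrite -[LHS](@mvle_subrK _ (mvneg a)) ?mvnegK 1?mvmulC // /mvle mvnegK.
have bcE : mvadd b c = mvadd (mvadd (mvmul a b) c) (mvneg a).
  by rewrite {1}bE -!mvaddA; congr mvadd; rewrite mvaddC.
rewrite bcE [RHS]mvmulC -[X in _ = mvmul _ X]mvnegK mvaddK //.
by apply: mvadd_neq1_le; rewrite -bcE.
Qed.

End LinearMVTheory.

(** * Chang's totally ordered group of a chain *)

Section ChangGroup.
Variable A : mvAlgType.

(* The pair [(n, a)] stands for [n u + a] in Chang's group of the chain [A], with
   [u] its strong unit; excluding [a = 1] makes the representation unique. The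
   hypotheses are arguments only so that the group structure can be inferred. *)
Definition chang (Alin : mv_linear A) (A01 : (mv0 : A) <> mv1) : Type :=
  (int * {a : A | a <> mv1})%type.

Hypothesis Alin : mv_linear A.
Hypothesis A01 : (mv0 : A) <> mv1.
Local Notation G := (chang Alin A01).
Implicit Types x y z : G.

HB.instance Definition _ := gen_eqMixin G.
HB.instance Definition _ := gen_choiceMixin G.

Lemma chang_inj x y : x.1 = y.1 -> sval x.2 = sval y.2 -> x = y.
Proof.
case: x y => [n [a ha]] [m [b hb]] /= -> ab.
by congr pair; exact: eq_exist.
Qed.

(** Addition with carry modulo [u]: once [a + b] reaches [u], one unit is carried and the remainder
    [a + b - u] is [mvmul a b]. *)
Definition chang_carry (a b : A) : nat := `[< mvadd a b = mv1 >].
Definition chang_sum (a b : A) : A :=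
  if `[< mvadd a b = mv1 >] then mvmul a b else mvadd a b.

Lemma chang_sum_neq1 (a b : A) : b <> mv1 -> chang_sum a b <> mv1.
Proof.
move=> b1; rewrite /chang_sum; case: asboolP => // _ ab1; apply: b1.
by have := mvle_mulr b a; rewrite ab1 /mvle mvneg1 mvadd0x.
Qed.

Definition chang_add x y : G :=
  ((x.1 + y.1 + (chang_carry (sval x.2) (sval y.2))%:Z)%R,
   exist (fun a : A => a <> mv1) _ (@chang_sum_neq1 (sval x.2) _ (svalP y.2))).

Definition chang_zero : G := (0%R, exist (fun a : A => a <> mv1) mv0 A01).

Lemma mvneg_neq1 (a : A) : a <> mv0 -> mvneg a <> mv1.
Proof. by move=> a0 a1; apply: a0; rewrite -[a]mvnegK a1 mvneg1. Qed.

(** In general [-(n u + a) = (-n - 1) u + (u - a)]; for [a = 0] the remainder would be the excluded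
    value 1, so this case is separate. *)
Definition chang_opp x : G :=
  match pselect (sval x.2 = mv0) with
  | left _ => (- x.1, x.2)%R
  | right h => (- x.1 - 1, exist (fun a : A => a <> mv1) _ (mvneg_neq1 h))%R
  end.

Let addC : commutative chang_add.
Proof.
move=> x y; apply: chang_inj => /=.
  by rewrite addrAC [RHS]addrAC [(x.1 + _)%R]addrC /chang_carry mvaddC; lia.
by rewrite /chang_sum mvaddC mvmulC.
Qed.

(** This is associativity of the group law, separated into carries and remainders. The cases are
    whether [a + b] and [b + c] carry, each settled by one of the mixed associativity laws. *)
Lemma chang_cocycle (a b c : A) :
  (chang_carry b c + chang_carry a (chang_sum b c) =
   chang_carry a b + chang_carry (chang_sum a b) c)%N /\
  chang_sum a (chang_sum b c) = chang_sum (chang_sum a b) c.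
Proof.
rewrite /chang_carry /chang_sum.
case: (asboolP (mvadd a b = mv1)) => ab; case: (asboolP (mvadd b c = mv1)) => bc.
- by rewrite -(mvmul_add_addA Alin ab bc) mvmulA; case: asboolP.
(* Exactly one carry on each side: a second carry on the right would force [a * (b + c) = 1], yet
   this product is at most [b + c], which is not 1. *)
- rewrite (mvmul_add_mulA Alin ab bc) mvaddA ab mvadd1x.
  case: asboolP => // _; case: asboolP => // h; exfalso; apply: bc.
  by have := mvle_mulr (mvadd b c) a; rewrite h /mvle mvneg1 mvadd0x.
- have cb : mvadd c b = mv1 by rewrite mvaddC.
  have ba : mvadd b a <> mv1 by rewrite mvaddC.
  have h : mvadd a (mvmul b c) = mvmul (mvadd a b) c.
    rewrite mvaddC (mvmulC b) (mvmul_add_mulA Alin cb ba) mvmulC.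
    by rewrite (mvaddC b).
  rewrite h -mvaddA bc mvaddx1.
  case: (asboolP (mv1 = mv1)) => // _; case: asboolP => // h1.
  exfalso; apply: ab; have := mvle_mulr (mvadd a b) c.
  by rewrite mvmulC h1 /mvle mvneg1 mvadd0x.
- rewrite -mvaddA; case: asboolP => // _; split => //; apply/esym.
  by apply: (mvadd_mul_mulA Alin); apply: (mvadd_neq1_le Alin).
Qed.

Let addA : associative chang_add.
Proof.
move=> x y z.
have [h1 h2] := chang_cocycle (sval x.2) (sval y.2) (sval z.2).
by apply: chang_inj => //=; lia.
Qed.

Let add0 : left_id chang_zero chang_add.
Proof.
move=> [n [a ha]]; apply: chang_inj => /=;
  rewrite /chang_carry /chang_sum mvadd0x; case: asboolP => //.
by rewrite add0r addr0.
Qed.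

Let addN : left_inverse chang_zero chang_opp chang_add.
Proof.
move=> [n [a ha]]; rewrite /chang_opp /=; case: pselect => /= a0;
  apply: chang_inj => /=; rewrite /chang_carry /chang_sum.
- by subst a; rewrite mvadd0x; case: asboolP => //; lia.
- by subst a; rewrite mvadd0x; case: asboolP.
- by rewrite mvaddNx; case: asboolP => //; lia.
- by rewrite mvaddNx; case: asboolP => // _; exact: mvmulNx.
Qed.

HB.instance Definition _ := GRing.isZmodule.Build G addA addC add0 addN.

(** Since [0 <= a < u], the integer part alone decides whether [n u + a] is nonnegative. *)
Definition chang_nneg x : bool := (0 <= x.1)%R.

Lemma chang_nnegD x y : chang_nneg x -> chang_nneg y -> chang_nneg (x + y)%R.
Proof.
rewrite /chang_nneg [(x + y)%R]/(chang_add x y) /= => x0 y0.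
by rewrite !addr_ge0.
Qed.

Lemma chang_nneg_total x : chang_nneg x || chang_nneg (- x)%R.
Proof.
rewrite /chang_nneg [(- x)%R]/(chang_opp x) /chang_opp.
by case: pselect => _ /=; lia.
Qed.

Lemma chang_nneg_anti x : chang_nneg x -> chang_nneg (- x)%R -> x = 0%R.
Proof.
rewrite /chang_nneg [(- x)%R]/(chang_opp x) /chang_opp.
case: pselect => h /= *; last by lia.
by apply: chang_inj => //=; lia.
Qed.

Definition chang_unit : G := (1%R, exist (fun a : A => a <> mv1) mv0 A01).

Definition chang_inc (a : A) : G :=
  match pselect (a = mv1) with
  | left _ => chang_unit
  | right h => (0%R, exist (fun a : A => a <> mv1) a h)
  end.

Lemma chang_incV (a : A) :
  a = mv1 /\ chang_inc a = chang_unit \/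
  exists h : a <> mv1, chang_inc a = (0%R, exist (fun a : A => a <> mv1) a h).
Proof. by rewrite /chang_inc; case: pselect => h; [left|right; exists h]. Qed.

Lemma chang_inc1 : chang_inc mv1 = chang_unit.
Proof. by case: (chang_incV mv1) => [[]|[]]. Qed.

Lemma chang_inc0 : chang_inc mv0 = 0%R.
Proof.
case: (chang_incV mv0) => [[]//|[h ->]].
exact: (@chang_inj _ chang_zero).
Qed.

Lemma chang_unit_neq0 : chang_unit <> 0%R.
Proof. by move/(congr1 fst). Qed.

Lemma chang_inc_inj : injective chang_inc.
Proof.
move=> a b; case: (chang_incV a) => [[-> ->]|[ha ->]];
  by case: (chang_incV b) => [[-> ->]|[hb ->]] //; case.
Qed.

Lemma chang_inc_nneg a : chang_nneg (chang_inc a).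
Proof. by case: (chang_incV a) => [[_ ->]|[h ->]]. Qed.

Lemma chang_incN a : (chang_inc (mvneg a) + chang_inc a = chang_unit)%R.
Proof.
case: (chang_incV a) => [[-> ->]|[h ->]].
  by rewrite mvneg1 chang_inc0 add0r.
case: (chang_incV (mvneg a)) => [[h1 ->]|[h1 ->]].
  have a0 : a = mv0 by rewrite -[a]mvnegK h1 mvneg1.
  rewrite -[RHS]addr0; congr +%R; exact: (@chang_inj _ chang_zero).
apply: chang_inj => /=; rewrite /chang_carry /chang_sum mvaddNx.
  by case: asboolP.
by case: asboolP => // _; exact: mvmulNx.
Qed.

Lemma chang_inc_le1 a : chang_nneg (chang_unit - chang_inc a)%R.
Proof. by rewrite -(chang_incN a) addrK chang_inc_nneg. Qed.

Lemma chang_incD a b : mvadd a b <> mv1 ->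
  chang_inc (mvadd a b) = (chang_inc a + chang_inc b)%R.
Proof.
move=> ab.
case: (chang_incV a) => [[a1 _]|[ha ->]]; first by rewrite a1 mvadd1x in ab.
case: (chang_incV b) => [[b1 _]|[hb ->]]; first by rewrite b1 mvaddx1 in ab.
case: (chang_incV (mvadd a b)) => [[]//|[hab ->]].
by apply: chang_inj => /=; rewrite /chang_carry /chang_sum; case: asboolP.
Qed.

(** The excess of the group sum over [u] is the image of [mvmul a b]. Together with [chang_incD]
    this presents the sum of [A] as truncated addition on [[0, u]]. *)
Lemma chang_incD_ge a b : mvadd a b = mv1 ->
  chang_nneg (chang_inc a + chang_inc b - chang_unit)%R.
Proof.
move=> ab.
case: (chang_incV a) => [[_ ->]|[ha haE]].
  by rewrite addrAC subrr add0r chang_inc_nneg.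
case: (chang_incV b) => [[_ ->]|[hb hbE]]; first by rewrite addrK chang_inc_nneg.
suff -> : (chang_inc a + chang_inc b = chang_inc (mvmul a b) + chang_unit)%R.
  by rewrite addrK chang_inc_nneg.
have abE : mvmul a b <> mv1.
  by have := @chang_sum_neq1 a b hb; rewrite /chang_sum; case: asboolP.
rewrite haE hbE; case: (chang_incV (mvmul a b)) => [[]//|[h ->]].
apply: chang_inj => /=; rewrite /chang_carry /chang_sum mvaddx0;
  by case: asboolP => //; case: asboolP.
Qed.

End ChangGroup.
(* A cut prescribed by finitely many signs is realised as soon as the signs are
   pairwise consistent. *)
Lemma exists_rat_sgz (L : seq (rat * int)) :
  (forall p, p \in L -> [\/ p.2 = 0, p.2 = 1 | p.2 = -1]%R) ->
  (forall p p', p \in L -> p' \in L -> (p'.2 < p.2 -> p.1 < p'.1)%R) ->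
  (forall p p', p \in L -> p' \in L -> (p.2 = 0 -> p'.2 = 0 -> p.1 = p'.1)%R) ->
  exists t : rat, forall p, p \in L -> sgz (t - p.1)%R = p.2.
Proof.
move=> Ls Llt Leq.
have [[p0 p0L p00]|no0] := pselect (exists2 p, p \in L & p.2 = 0%R).
  (* A prescribed zero leaves only one candidate for the point. *)
  exists p0.1 => p pL; case: (Ls p pL) => ps; rewrite ps.
  - by rewrite (Leq p0 p) // subrr sgz0.
  - by rewrite gtr0_sgz // subr_gt0 Llt // ps p00.
  - by rewrite ltr0_sgz // subr_lt0 Llt // ps p00.
have {}Ls p : p \in L -> (p.2 = 1 \/ p.2 = -1)%R.
  by move=> pL; case: (Ls p pL) => h; [case: no0; exists p|left|right].
pose lo := [seq p.1 | p <- L & p.2 == 1%R].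
pose hi := [seq p.1 | p <- L & p.2 == (-1)%R].
suff [t [tlo thi]] : exists t : rat,
    (forall v, v \in lo -> v < t)%R /\ (forall v, v \in hi -> t < v)%R.
  exists t => p pL; case: (Ls p pL) => ps; rewrite ps.
    rewrite gtr0_sgz // subr_gt0 tlo //.
    by apply/mapP; exists p => //; rewrite mem_filter ps eqxx pL.
  rewrite ltr0_sgz // subr_lt0 thi //.
  by apply/mapP; exists p => //; rewrite mem_filter ps eqxx pL.
have lohi a b : a \in lo -> b \in hi -> (a < b)%R.
  move=> /mapP[p + ->] /mapP[p' + ->]; rewrite !mem_filter.
  by move=> /andP[/eqP p1 pL] /andP[/eqP p'1 p'L]; apply: Llt; rewrite // p1 p'1.
move: lo hi lohi {Llt Leq no0 Ls} => lo hi lohi.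
(* First comes a point weakly above [lo] and strictly below [hi]. A second induction, over [hi],
   makes both bounds strict by moving up to at most the midpoint of [m] and each upper bound. *)
have [m [mlo mhi]] : exists m : rat,
    (forall v, v \in lo -> v <= m)%R /\ (forall v, v \in hi -> m < v)%R.
  elim: lo lohi => [_|a lo IH lohi].
    elim: hi => [|b hi [m [_ IH]]]; first by exists 0%R.
    exists (Num.min m (b - 1))%R; split=> // v; rewrite inE => /orP[/eqP ->|/IH h].
      by rewrite gt_min ltrBlDr ltrDl ltr01 orbT.
    by rewrite gt_min h.
  have [|m [h1 h2]] := IH; first by move=> x y xlo; apply: lohi; rewrite inE xlo orbT.
  exists (Num.max a m); split=> v.
    by rewrite inE le_max => /orP[/eqP ->|/h1 ->]; rewrite ?lexx ?orbT.
  by move=> vh; rewrite gt_max h2 // lohi // mem_head.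
elim: hi mhi {lohi} => [_|b hi IH mhi].
  by exists (m + 1)%R; split=> // v /mlo h; rewrite (le_lt_trans h) // ltrDl.
have [|t [t1 t2]] := IH; first by move=> v vh; apply: mhi; rewrite inE vh orbT.
exists (Num.min t ((m + b) / 2))%R; split=> v.
  move=> vlo; rewrite lt_min t1 //=; have := mhi b (mem_head _ _); have := mlo v vlo; lra.
rewrite inE gt_min => /orP[/eqP ->|/t2 -> //].
by apply/orP; right; have := mhi b (mem_head _ _); lra.
Qed.

(** * Signs of integer linear forms in an ordered group *)

Section OrderedGroupSign.
Local Open Scope ring_scope.
Variables (G : zmodType) (P : pred G).
Hypothesis PD : forall x y, P x -> P y -> P (x + y).
Hypothesis Ptotal : forall x, P x || P (- x).
Hypothesis Panti : forall x, P x -> P (- x) -> x = 0.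

Definition gsgz (x : G) : int := if x == 0 then 0 else if P x then 1 else -1.

Lemma gsgz0 : gsgz 0 = 0.
Proof. by rewrite /gsgz eqxx. Qed.

Lemma gsgz_eq0 x : (gsgz x == 0) = (x == 0).
Proof. by rewrite /gsgz; case: ifP => // _; case: ifP. Qed.

Lemma gsgz_ge0 x : (0 <= gsgz x) = P x.
Proof.
have P0 : P 0 by have := Ptotal 0; rewrite oppr0 orbb.
by rewrite /gsgz; case: (x =P 0) => [->|_]; [rewrite P0|case: ifP].
Qed.

Lemma gsgzN x : gsgz (- x) = - gsgz x.
Proof.
rewrite /gsgz oppr_eq0; case: (x =P 0) => [_|/eqP x0]; first by rewrite oppr0.
have := Ptotal x; case Px: (P x); case PNx: (P (- x)) => //= _.
by rewrite (Panti Px PNx) eqxx in x0.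
Qed.

Lemma gsgz_cases x : [\/ gsgz x = 0, gsgz x = 1 | gsgz x = -1].
Proof.
by rewrite /gsgz; case: ifP => _; [apply: Or31|case: ifP => _; [apply: Or32|apply: Or33]].
Qed.

Lemma gsgzD_gt0 x y : gsgz x = 1 -> 0 <= gsgz y -> gsgz (x + y) = 1.
Proof.
move=> x1; rewrite gsgz_ge0 => Py; have Px : P x by rewrite -gsgz_ge0 x1.
have xy0 : x + y != 0.
  apply/eqP => /eqP; rewrite addr_eq0 => /eqP xE.
  have x0 : x = 0 by apply: Panti Px _; rewrite xE opprK.
  by move: x1; rewrite x0 gsgz0.
by rewrite /gsgz (negPf xy0) PD.
Qed.

Lemma gsgzMn x n : gsgz (x *+ n.+1) = gsgz x.
Proof.
have pos y m : gsgz y = 1 -> gsgz (y *+ m.+1) = 1.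
  move=> y1; elim: m => [|m IH]; first by rewrite mulr1n.
  by rewrite mulrS; apply: gsgzD_gt0 => //; rewrite IH.
case: (gsgz_cases x) => xs.
- by move/eqP: xs; rewrite gsgz_eq0 => /eqP ->; rewrite mul0rn.
- by rewrite xs pos.
- by rewrite xs -[x]opprK mulNrn gsgzN pos // gsgzN xs.
Qed.

Lemma gsgzMz x (n : int) : gsgz (x *~ n) = sgz n * gsgz x.
Proof.
case: n => [[|n]|n]; first by rewrite mulr0z gsgz0 sgz0 mul0r.
  by rewrite -pmulrn gsgzMn gtr0_sgz // mul1r.
by rewrite NegzE mulrNz gsgzN -pmulrn gsgzMn sgzN gtr0_sgz // mulN1r.
Qed.

Lemma gsgzB_gt0 x y : gsgz y < gsgz x -> gsgz (x - y) = 1.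
Proof.
move=> h; have : gsgz x = 1 /\ 0 <= gsgz (- y) \/ gsgz (- y) = 1 /\ 0 <= gsgz x.
  by rewrite gsgzN; case: (gsgz_cases x) (gsgz_cases y) h => -> [] -> //=; [right|left|left].
by case=> -[h1 h2]; [|rewrite addrC]; apply: gsgzD_gt0.
Qed.

Definition form (k : nat) (c : seq int) (g : nat -> G) : G :=
  \sum_(i < k) g i *~ c`_i.

Definition ratform (k : nat) (c : seq int) (q : nat -> rat) : rat :=
  \sum_(i < k) (c`_i)%:~R * q i.



Lemma formS k c g : form k.+1 c g = form k c g + g k *~ c`_k.
Proof. by rewrite /form big_ord_recr. Qed.

Lemma ratformS k c q : ratform k.+1 c q = ratform k c q + (c`_k)%:~R * q k.
Proof. by rewrite /ratform big_ord_recr. Qed.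

(** Cross-multiplying by the coefficients of variable [k] cancels that variable. *)
Definition elim_form (k : nat) (c d : seq int) : seq int :=
  mkseq (fun i => c`_i * d`_k - d`_i * c`_k) k.

Lemma form_elim k c d g :
  form k (elim_form k c d) g = form k.+1 c g *~ d`_k - form k.+1 d g *~ c`_k.
Proof.
rewrite !formS !mulrzDl -!mulrzA [d`_k * _]mulrC opprD addrACA subrr addr0.
rewrite /form !mulrz_suml -sumrB; apply: eq_bigr => i _.
by rewrite nth_mkseq // mulrzBr !mulrzA.
Qed.

Lemma ratform_elim k c d q :
  ratform k (elim_form k c d) q =
  ratform k c q * (d`_k)%:~R - ratform k d q * (c`_k)%:~R.
Proof.
rewrite /ratform !mulr_suml -sumrB; apply: eq_bigr => i _.
by rewrite nth_mkseq // intrB !intrM; ring.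
Qed.

(* Fourier-Motzkin elimination of the last variable. *)
Lemma exists_ratform_sgz k g (L : seq (seq int)) :
  exists q : nat -> rat,
    forall c, c \in L -> sgz (ratform k c q) = gsgz (form k c g).
Proof.
elim: k L => [|k IH] L.
  by exists (fun=> 0) => c _; rewrite /ratform /form !big_ord0 gsgz0 sgz0.
have [q qL] := IH (L ++ [seq elim_form k c d | c <- L, d <- L]).
(* [v c] is the value of the last variable at which the form [c] vanishes, and [s c] the sign that
   [t - v c] must take. *)
pose v c := - ratform k c q / (c`_k)%:~R.
pose s c := gsgz (form k.+1 c g *~ c`_k).
(* The difference of two roots is, up to a positive square, a signed eliminated form, whose sign the
   induction hypothesis controls. Multiplying by squares replaces division, which the group
   lacks. *)
have vB c d : c \in L -> d \in L -> c`_k != 0 -> d`_k != 0 ->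
    sgz (v d - v c) = gsgz (form k.+1 c g *~ c`_k *~ (d`_k ^+ 2) -
                            form k.+1 d g *~ d`_k *~ (c`_k ^+ 2)).
  move=> cL dL c0 d0.
  have cq0 : (c`_k)%:~R != 0 :> rat by rewrite intr_eq0.
  have dq0 : (d`_k)%:~R != 0 :> rat by rewrite intr_eq0.
  have -> : v d - v c =
      (c`_k * d`_k)%:~R * ratform k (elim_form k c d) q *
      ((c`_k * d`_k)%:~R ^+ 2)^-1.
    by rewrite ratform_elim /v intrM; field; rewrite cq0 dq0.
  have cd_gt0 : 0 < ((c`_k * d`_k)%:~R ^+ 2)^-1 :> rat.
    by rewrite invr_gt0 exprn_even_gt0 //= intr_eq0 mulf_neq0.
  rewrite sgzM (gtr0_sgz cd_gt0) mulr1 sgzM sgz_int qL; last first.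
    by rewrite mem_cat; apply/orP; right; apply/allpairsP; exists (c, d).
  rewrite -gsgzMz form_elim mulrzBl -!mulrzA; congr (gsgz (_ *~ _ - _ *~ _)); ring.
have sq x (n : int) : n != 0 -> gsgz (x *~ (n ^+ 2)) = gsgz x.
  by move=> n0; rewrite gsgzMz gtr0_sgz ?mul1r // exprn_even_gt0.
have [|||t tP] := @exists_rat_sgz [seq (v c, s c) | c <- L & c`_k != 0].
- by move=> _ /mapP[c _ ->] /=; exact: gsgz_cases.
- move=> _ _ /mapP[c + ->] /mapP[d + ->] /=; rewrite !mem_filter.
  move=> /andP[c0 cL] /andP[d0 dL] sdc.
  rewrite -subr_gt0 -sgz_gt0 vB //.
  by rewrite gsgzB_gt0 // !sq.
- move=> _ _ /mapP[c + ->] /mapP[d + ->] /=; rewrite !mem_filter.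
  move=> /andP[c0 cL] /andP[d0 dL] /eqP + /eqP; rewrite !gsgz_eq0 => /eqP sc /eqP sd.
  apply/eqP; rewrite eq_sym -subr_eq0 -sgz_eq0 vB // sc sd.
  by rewrite !mul0rz subrr gsgz0.
exists (fun i => if i == k then t else q i) => c cL.
rewrite ratformS eqxx.
have -> : ratform k c (fun i => if i == k then t else q i) = ratform k c q.
  by apply: eq_bigr => i _; rewrite ltn_eqF.
have [c0|c0] := eqVneq c`_k 0.
  by rewrite formS c0 mulr0z mul0r !addr0 qL // mem_cat cL.
have cq0 : (c`_k)%:~R != 0 :> rat by rewrite intr_eq0.
have -> : ratform k c q + (c`_k)%:~R * t = (c`_k)%:~R * (t - v c).
  by rewrite /v; field.
have -> : sgz ((c`_k)%:~R * (t - v c)) = sgz c`_k * s c.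
  rewrite sgzM sgz_int; congr (_ * _); apply: (tP (v c, s c)).
  by apply/mapP; exists c => //; rewrite mem_filter c0 cL.
by rewrite /s -gsgzMz -mulrzA -expr2 sq.
Qed.

End OrderedGroupSign.

(** * Integer points realising the signs of three-term forms *)

Section IntegerModel.
Local Open Scope ring_scope.
Variables (G : zmodType) (P : pred G).
Hypothesis PD : forall x y, P x -> P y -> P (x + y).
Hypothesis Ptotal : forall x, P x || P (- x).
Hypothesis Panti : forall x, P x -> P (- x) -> x = 0.

Definition triple_form (k i j l : nat) : seq int :=
  mkseq (fun m => (m == i)%:Z + (m == j)%:Z - (m == l)%:Z) k.

Lemma form_triple k i j l (g : nat -> G) : (i < k)%N -> (j < k)%N -> (l < k)%N ->
  form k (triple_form k i j l) g = g i + g j - g l.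
Proof.
have sel n : (n < k)%N -> \sum_(m < k) g m *~ (m == n :> nat)%:Z = g n.
  move=> nk; rewrite (bigD1 (Ordinal nk)) //= eqxx mulr1z big1 ?addr0 // => m.
  by rewrite -val_eqE /= => /negPf ->; rewrite mulr0z.
move=> ik jk lk; rewrite -(sel i ik) -(sel j jk) -(sel l lk).
rewrite -big_split -sumrB; apply: eq_bigr => m _ /=.
by rewrite nth_mkseq // mulrzBr mulrzDr.
Qed.

Lemma ratform_triple k i j l q : (i < k)%N -> (j < k)%N -> (l < k)%N ->
  ratform k (triple_form k i j l) q = q i + q j - q l.
Proof.
have sel n : (n < k)%N -> \sum_(m < k) (m == n :> nat)%:R * q m = q n.
  move=> nk; rewrite (bigD1 (Ordinal nk)) //= eqxx mul1r big1 ?addr0 // => m.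
  by rewrite -val_eqE /= => /negPf ->; rewrite mul0r.
move=> ik jk lk; rewrite -(sel i ik) -(sel j jk) -(sel l lk).
rewrite -big_split -sumrB; apply: eq_bigr => m _ /=.
by rewrite nth_mkseq // intrB intrD mulrBl mulrDl.
Qed.

Lemma common_denominator k (q : nat -> rat) :
  exists2 d : int, 0 < d & forall i, (i < k)%N -> exists z : int, d%:~R * q i = z%:~R.
Proof.
elim: k => [|k [d d0 dP]]; first by exists 1.
exists (d * denq (q k)); first by rewrite mulr_gt0 ?denq_gt0.
move=> i; rewrite ltnS leq_eqVlt => /orP[/eqP ->|/dP[z zP]].
  by exists (d * numq (q k)); rewrite !intrM numqE; ring.
by exists (z * denq (q k)); rewrite !intrM -zP; ring.
Qed.

(** The elements of [S], numbered by position, become variables of a rational solution; multiplying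
    it by a positive common denominator keeps every sign. *)
Lemma exists_int_sgz (S : seq G) :
  exists phi : G -> int, forall x y z, x \in S -> y \in S -> z \in S ->
    sgz (phi x + phi y - phi z) = gsgz P (x + y - z).
Proof.
set k := size S; pose r := iota 0 k.
have [q qP] := exists_ratform_sgz PD Ptotal Panti k (nth 0 S)
  [seq triple_form k p.1 p.2 l | p <- [seq (i, j) | i <- r, j <- r], l <- r].
have [d d0 dP] := common_denominator k q.
exists (fun x => numq (d%:~R * q (index x S))) => x y z xS yS zS.
have phiE w : w \in S -> (numq (d%:~R * q (index w S)))%:~R = d%:~R * q (index w S) :> rat.
  by rewrite -index_mem => /dP[n ->]; rewrite numq_int.
rewrite -(@sgz_int rat) intrB intrD !phiE // -mulrDr -mulrBr sgzM sgz_int.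
rewrite (gtr0_sgz d0) mul1r -(@ratform_triple k) ?index_mem // qP; last first.
  apply/allpairsP; exists ((index x S, index y S), index z S) => /=.
  rewrite !mem_iota !add0n !leq0n !index_mem zS; split=> //.
  by apply/allpairsP; exists (index x S, index y S); rewrite !mem_iota !index_mem.
by rewrite form_triple ?index_mem // !nth_index.
Qed.

End IntegerModel.

(** * Finite Lukasiewicz chains and partial embeddings into them *)

Section LukasiewiczChain.
Variable n : nat.

(* The chain {0, 1/n, ..., 1}, with i standing for i/n. *)
Definition luk : Type := 'I_n.+1.
Implicit Types x y : luk.

Lemma luk_add_subproof x y : (minn (x + y) n < n.+1)%N.
Proof. by rewrite ltnS geq_minr. Qed.

Lemma luk_neg_subproof x : (n - x < n.+1)%N.
Proof. by rewrite ltnS leq_subr. Qed.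

Definition luk_add x y : luk := Ordinal (luk_add_subproof x y).
Definition luk_neg x : luk := Ordinal (luk_neg_subproof x).

Let addC : commutative luk_add.
Proof. by move=> x y; apply: val_inj => /=; rewrite addnC. Qed.

Let addA : associative luk_add.
Proof. by move=> x y z; apply: val_inj => /=; lia. Qed.

Let addx0 x : luk_add x ord0 = x.
Proof. by apply: val_inj => /=; have := ltn_ord x; lia. Qed.

Let negK x : luk_neg (luk_neg x) = x.
Proof. by apply: val_inj => /=; have := ltn_ord x; lia. Qed.

Let addx1 x : luk_add x (luk_neg ord0) = luk_neg ord0.
Proof. by apply: val_inj => /=; lia. Qed.

Let lukE x y : luk_add (luk_neg (luk_add (luk_neg x) y)) y =
  luk_add (luk_neg (luk_add (luk_neg y) x)) x.
Proof.
by apply: val_inj => /=; have := ltn_ord x; have := ltn_ord y; lia.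
Qed.

HB.instance Definition _ := isMVAlgebra.Build luk addC addA addx0 negK addx1 lukE.

Lemma luk_finite : finite_set [set: luk].
Proof. exact: (@finite_finset 'I_n.+1). Qed.

Lemma luk_linear : mv_linear luk.
Proof.
move=> x y; case: (leqP x y) => xy; [left|right]; apply: val_inj => /=; lia.
Qed.

End LukasiewiczChain.

Section LukUnit.
Local Open Scope ring_scope.
Variables (F : realFieldType) (n : nat).

Lemma luk_unitI_subproof (x : luk n.+1) : 0 <= (x%:R / n.+1%:R : F) <= 1.
Proof.
rewrite divr_ge0 ?ler0n //= ler_pdivrMr ?ltr0n // mul1r ler_nat.
by rewrite -ltnS ltn_ord.
Qed.

(** The successor keeps the denominator nonzero; [luk 0] is the one-element algebra. *)
Definition luk_unitI (x : luk n.+1) : unitI F :=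
  exist (fun z : F => 0 <= z <= 1) _ (luk_unitI_subproof x).

Lemma luk_unitI_embedding : mv_embedding luk_unitI.
Proof.
have n0 : n.+1%:R != 0 :> F by rewrite pnatr_eq0.
split=> [x y /(congr1 sval)/= /(mulIf (invr_neq0 n0))/eqP|x y|x|].
- by rewrite eqr_nat => /eqP /val_inj.
- apply: val_inj; rewrite /= -mulrDl -natrD.
  case: (leqP (x + y) n.+1) => h.
    by apply/esym/min_idPl; rewrite ler_pdivrMr ?ltr0n // mul1r ler_nat.
  rewrite divff //; apply/esym/min_idPr.
  by rewrite ler_pdivlMr ?ltr0n // mul1r ler_nat ltnW.
- apply: val_inj; rewrite /= natrB; last by rewrite -ltnS ltn_ord.
  by rewrite mulrBl divff.
- by apply: val_inj; rewrite /= mul0r.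
Qed.

End LukUnit.
(** An integer model of [0], [u] and the image of [S] places that image in [[0, phi u]], where the
    truncated operations are those of the chain with top [phi u]. *)
Lemma finite_partial_embedding (A : mvAlgType) (S : set A) :
  mv_linear A -> (mv0 : A) <> mv1 -> finite_set S ->
  exists (n : nat) (f : A -> luk n.+1),
  [/\ f mv0 = mv0,
      forall x y, S x -> S y -> S (mvadd x y) -> f (mvadd x y) = mvadd (f x) (f y),
      forall x, S x -> S (mvneg x) -> f (mvneg x) = mvneg (f x) &
      forall x y, S x -> S y -> f x = f y -> x = y].
Proof.
move=> Alin A01 Sfin; pose i := @chang_inc A Alin A01.
pose u := chang_unit Alin A01; pose P := @chang_nneg A Alin A01.
have Ptot : forall x, P x || P (- x)%R := @chang_nneg_total A Alin A01.
have /finite_seqP[s sE] := finite_image i Sfin.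
have [phi phiP] := exists_int_sgz (@chang_nnegD A Alin A01) Ptot
  (@chang_nneg_anti A Alin A01) [:: 0%R, u & s].
(* With [0] and [u] included, bounds, equalities and complements all become forms [x + y - z]. *)
set s' := [:: 0%R, u & s] in phiP.
have s'0 : 0%R \in s' by rewrite inE eqxx.
have s'u : u \in s' by rewrite !inE eqxx orbT.
have s'S x : S x -> i x \in s'.
  move=> Sx; rewrite !inE; apply/orP; right; apply/orP; right.
  by have : (i @` S) (i x) by [exists x]; rewrite sE.
have phi_eq x y z : x \in s' -> y \in s' -> z \in s' -> (x + y = z)%R ->
    (phi x + phi y = phi z)%R.
  move=> xs ys zs xyz; apply/eqP; rewrite -subr_eq0 -sgz_eq0 phiP // xyz subrr.
  by rewrite gsgz0.
have phi_ge x y z : x \in s' -> y \in s' -> z \in s' -> P (x + y - z)%R ->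
    (phi z <= phi x + phi y)%R.
  by move=> xs ys zs xyz; rewrite -subr_ge0 -sgz_ge0 phiP // gsgz_ge0.
have phi0 : phi 0%R = 0%R.
  have /eqP := phi_eq _ _ _ s'0 s'0 s'0 (addr0 0%R).
  by rewrite -subr_eq0 addrK => /eqP.
have phiu : (0 < phi u)%R.
  have : sgz (phi u + phi 0 - phi 0)%R = gsgz P (u + 0 - 0)%R by exact: phiP.
  rewrite addrK subr0 addr0 -sgz_gt0 => ->.
  by rewrite /gsgz; case: (u =P 0%R) => [/chang_unit_neq0|].
have phi_bounds x : S x -> (0 <= phi (i x) <= phi u)%R.
  move=> /s'S xs; apply/andP; split.
    have := phi_ge (i x) 0%R 0%R xs s'0 s'0; rewrite phi0 subr0 !addr0; apply.
    exact: chang_inc_nneg.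
  have := phi_ge u 0%R (i x) s'u s'0 xs; rewrite phi0 !addr0; apply.
  exact: chang_inc_le1.
have nE : `|phi u|%N.-1.+1 = `|phi u|%N by lia.
(* The predecessor offsets the successor in [luk n.+1], as [phi u > 0]. The default of [inord] is
   never reached on [S], where values lie between 0 and [phi u]. *)
exists `|phi u|%N.-1, (fun x => inord `|phi (i x)|%N).
have vf x : S x -> nat_of_ord (inord `|phi (i x)|%N : luk `|phi u|%N.-1.+1) = `|phi (i x)|%N.
  by move=> Sx; rewrite inordK //; have := phi_bounds x Sx; lia.
split.
- apply: val_inj; rewrite /i chang_inc0 phi0 /=.
  by rewrite inordK.
- move=> x y Sx Sy Sxy; apply: val_inj; rewrite /= !vf //.
  have [xy1|xy1] := pselect (mvadd x y = mv1).
    have := phi_ge _ _ _ (s'S x Sx) (s'S y Sy) s'u (chang_incD_ge Alin A01 xy1).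
    have := phi_bounds x Sx; have := phi_bounds y Sy.
    have -> : i (mvadd x y) = u by rewrite xy1; exact: chang_inc1.
    lia.
  have := phi_eq _ _ _ (s'S x Sx) (s'S y Sy) (s'S _ Sxy) (esym (chang_incD Alin A01 xy1)).
  have := phi_bounds x Sx; have := phi_bounds y Sy; have := phi_bounds _ Sxy; lia.
- move=> x Sx SNx; apply: val_inj; rewrite /= !vf //.
  have := phi_eq _ _ _ (s'S _ SNx) (s'S _ Sx) s'u (chang_incN Alin A01 x).
  have := phi_bounds x Sx; have := phi_bounds _ SNx; lia.
- move=> x y Sx Sy /(congr1 val) /=; rewrite !vf // => fxy.
  have {}fxy : phi (i x) = phi (i y).
    by have := phi_bounds x Sx; have := phi_bounds _ Sy; lia.
  (* The difference is rewritten as the three-term form [i x + 0 - i y], so that [phi] detects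
     whether it vanishes. *)
  apply: (@chang_inc_inj A Alin A01); apply/eqP; rewrite -subr_eq0.
  rewrite -(gsgz_eq0 P) -[X in gsgz P (X - _)%R]addr0 -/i -phiP ?s'S //.
  by rewrite fxy phi0 addr0 subrr sgz0.
Qed.

(** Each law is needed only almost everywhere. For injectivity, the index sets where two images
    agree and where they differ cannot both belong to [U], being disjoint. *)
Lemma ultraproduct_embeds (I : Type) (U : set_system I) (UU : UltraFilter U)
    (A : mvAlgType) (C : I -> mvAlgType) (f : forall i, A -> C i) :
  (forall x y, U [set i | f i (mvadd x y) = mvadd (f i x) (f i y)]) ->
  (forall x, U [set i | f i (mvneg x) = mvneg (f i x)]) ->
  U [set i | f i mv0 = mv0] ->
  (forall x y, x <> y -> U [set i | f i x <> f i y]) ->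
  mv_embeds A (ultraproduct U C).
Proof.
move=> fD fN f0 fI.
exists (fun x => (\pi_(@ultraproduct _ U UU C) (fun i => f i x))%qT); split=> [x y|x y|x|].
- move=> /ultra_piP Exy; apply: contrapT => /fI nExy.
  by have /filter_ex[i []] : U ([set i | f i x = f i y] `&` [set i | f i x <> f i y])
    by exact: filterI.
- by rewrite [RHS]ultra_addE; apply/ultra_piP; exact: fD.
- by rewrite [RHS]ultra_negE; apply/ultra_piP; exact: fN.
- by apply/ultra_piP; exact: f0.
Qed.

(** * Cones of finite subsets and regularity *)

Section FiniteSubsets.
Variable alpha : Type.

Definition cone (a : alpha) : set (finite_subset alpha) := [set X | sval X a].

(** The filter generated by the cones: a finite intersection of cones consists of all [X] above a
    fixed finite [Y]. *)
Definition cone_filter : set_system (finite_subset alpha) :=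
  [set D | exists Y : finite_subset alpha,
           forall X : finite_subset alpha, sval Y `<=` sval X -> D X].

Lemma cone_filter_cone a : cone_filter (cone a).
Proof.
exists (exist (fun X : set alpha => finite_set X) [set a] (finite_set1 a)) => X.
by apply.
Qed.

Lemma cone_filter_proper : ProperFilter cone_filter.
Proof.
split; first by case=> Y /(_ Y); apply.
split.
- by exists (exist (fun X : set alpha => finite_set X) set0 (finite_set0 _)).
- move=> D D' [Y hY] [Y' hY'].
  have fin : finite_set (sval Y `|` sval Y').
    by rewrite finite_setU; split; apply: svalP.
  exists (exist (fun X : set alpha => finite_set X) _ fin) => X /= YX; split.
    by apply: hY => a Ya; apply: YX; left.
  by apply: hY' => a Ya; apply: YX; right.
- by move=> D D' DD' [Y hY]; exists Y => X /hY /DD'.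
Qed.

(** The cones themselves form the regular family: singletons tell them apart, and [X] lies only in
    the cones of its finitely many elements. *)
Lemma regular_of_cones (U : set_system (finite_subset alpha)) :
  ProperFilter U -> (forall a, U (cone a)) -> regular_filter alpha U.
Proof.
move=> UP Ucone; split=> //; exists (range cone); split.
- by move=> _ [a _ <-].
- apply: inj_card_eq => a b _ _ ab.
  have: cone a (exist (fun X : set alpha => finite_set X) [set a] (finite_set1 a)).
    by [].
  by rewrite ab.
- move=> X; apply: sub_finite_set (finite_image cone (svalP X)).
  by move=> _ [[a _ <-] Xa]; exists a.
Qed.

End FiniteSubsets.

(** * One ultrafilter for all chains, and the three embeddings *)

Theorem theorem10 (R : realType) (alpha : Type)
    (alpha_infinite : infinite_set [set: alpha]) :
  exists (U : set_system (finite_subset alpha)) (UU : UltraFilter U),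
    regular_filter alpha U /\
    forall M : mvAlgType, mv_linear M -> ([set: M] #<= [set: alpha])%card ->
      (exists C : finite_subset alpha -> mvAlgType,
         (forall X, finite_set [set: C X] /\ mv_linear (C X)) /\
         mv_embeds M (ultraproduct U C)) /\
      ((mv0 : M) <> mv1 ->
         mv_embeds M (ultraproduct U (fun _ => unitI rat)) /\
         mv_embeds M (ultraproduct U (fun _ => unitI R))).
Proof.
have [U [UU coneU]] := ultraFilterLemma (@cone_filter_proper alpha).
have Ucone a : U (cone a) by exact/coneU/cone_filter_cone.
exists U, UU; split; first exact: regular_of_cones.
move=> M Mlin Malpha.
(* If [0 = 1], then [M] has one element and embeds into an ultraproduct of copies of [luk 0]. An
   embedding would carry [0 = 1] to the unit intervals, where it fails, so (2) and (3) concern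
   [0 <> 1]. *)
have [M01|M01] := pselect ((mv0 : M) = mv1).
  split=> //; exists (fun=> luk 0); split.
    by move=> X; split; [exact: luk_finite|exact: luk_linear].
  have Mtriv (x y : M) : x = y.
    have all0 z : z = mv0 :> M by rewrite M01 -(mvadd1x z) -M01 mvadd0x.
    by rewrite (all0 x) (all0 y).
  apply: (@ultraproduct_embeds _ U UU M (fun=> luk 0) (fun _ _ => mv0)).
  - by move=> x y; apply: filterE => X /=; rewrite mvaddx0.
  - by move=> x; apply: filterE => X /=; apply: val_inj.
  - exact: filterE.
  - by move=> x y /(_ (Mtriv x y)).
have [j jinj] : exists j : M -> alpha, injective j.
  move/card_leP: Malpha => [f]; exists (fun x => val (f (to_setT x))) => x y.
  by move=> /val_inj /('inj_f) xy; have /(congr1 val) := xy (mem_set I) (mem_set I).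
(* Through [j], the index [X] sees only the finitely many elements of [M] coded in [X]. *)
have fin (X : finite_subset alpha) : finite_set (j @^-1` sval X).
  by apply: finite_preimage (svalP X) => x y _ _; exact: jinj.
have [n nP] := choice (fun X => finite_partial_embedding Mlin M01 (fin X)).
pose good X (f : M -> luk (n X).+1) := [/\ f mv0 = mv0,
  forall x y, sval X (j x) -> sval X (j y) -> sval X (j (mvadd x y)) ->
    f (mvadd x y) = mvadd (f x) (f y),
  forall x, sval X (j x) -> sval X (j (mvneg x)) -> f (mvneg x) = mvneg (f x) &
  forall x y, sval X (j x) -> sval X (j y) -> f x = f y -> x = y].
have f_ X : {f | @good X f} by exact/cid/nP.
(* One gluing argument serves all three claims: [e] is the identity for the finite chains and
   [luk_unitI] for the unit intervals. *)
have embeds (C : finite_subset alpha -> mvAlgType)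
    (e : forall X, luk (n X).+1 -> C X) :
  (forall X, mv_embedding (e X)) -> mv_embeds M (ultraproduct U C).
  move=> eP; apply: (@ultraproduct_embeds _ U UU M C (fun X x => e X (sval (f_ X) x))).
  (* On the intersection of these three cones, the partial embedding sees both arguments and their
     sum. *)
  - move=> x y; apply: filterS3 (Ucone (j x)) (Ucone (j y)) (Ucone (j (mvadd x y))).
    move=> X Xx Xy Xxy /=; case: (eP X) => _ eD _ _; rewrite -eD; congr (e X _).
    by case: (svalP (f_ X)) => _ fD _ _; exact: fD.
  - move=> x; apply: filterS2 (Ucone (j x)) (Ucone (j (mvneg x))) => X Xx XNx /=.
    case: (eP X) => _ _ eN _; rewrite -eN; congr (e X _).
    by case: (svalP (f_ X)) => _ _ fN _; exact: fN.
  - apply: filterE => X /=; case: (eP X) => _ _ _ <-; congr (e X _).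
    by case: (svalP (f_ X)).
  - move=> x y xy; apply: filterS2 (Ucone (j x)) (Ucone (j y)) => X Xx Xy /=.
    case: (eP X) => eI _ _ _ /eI; case: (svalP (f_ X)) => _ _ _ fI.
    by move/fI => /(_ Xx Xy).
split; last first.
  move=> _; split; apply: (embeds (fun=> unitI _) (fun X => @luk_unitI _ (n X)));
    by move=> X; exact: luk_unitI_embedding.
exists (fun X => luk (n X).+1); split.
  by move=> X; split; [exact: luk_finite|exact: luk_linear].
by apply: (embeds _ (fun X => id)) => X; split.
Qed.
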